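(* The following derivative identities hold: \begin{itemize} \item $\frac{d}{dx}\exp(x) = \exp(x)$ for $x \in \mathbb{R}$; \item $\frac{d}{dx}\log(x) = 1/x$ for $x > 0$; \item for $a \in \mathbb{R}$, $\frac{d}{dx}x^a = a x^{a-1}$ for $x > 0$; moreover for all $x \in \mathbb{R}$ if $a$ is a positive integer, and for all $x \neq 0$ if $a$ is an integer with $a \le 0$; \item for real $b > 0$, $\frac{d}{dx}b^x = b^x\log(b)$ for $x \in \mathbb{R}$; \item $\frac{d}{dx}\sin(x) = \cos(x)$ and $\frac{d}{dx}\cos(x) = -\sin(x)$ for $x \in \mathbb{R}$; \item $\frac{d}{dx}\tan(x) = \sec^2(x)$ for all $x \in \mathbb{R}$ with $\cos(x) \ne 0$; \item $\frac{d}{dx}\cot(x) = -\csc^2(x)$ for all $x \in \mathbb{R}$ with $\sin(x) \neq 0$; \item $\frac{d}{dx}\arctan(x) = \frac{1}{1+x^2}$ for $x \in \mathbb{R}$; \item $\frac{d}{dx}\arcsin(x) = \frac{1}{\sqrt{1-x^2}}$ for $x \in (-1,1)$; \item $\frac{d}{dx}\sinh(x) = \cosh(x)$, $\frac{d}{dx}\cosh(x) = \sinh(x)$, and $\frac{d}{dx}\tanh(x) = \operatorname{sech}^2(x)$ for $x \in \mathbb{R}$; \item $\frac{d}{dx}\operatorname{arsinh}(x) = \frac{1}{\sqrt{1+x^2}}$ for $x \in \mathbb{R}$. \end{itemize}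
   Context: For $x>0$, $\log(x) := \int_1^x \frac{dt}{t}$ (Riemann integral, with $\int_1^x = -\int_x^1$ for $x<1$), a bijection from $(0,\infty)$ onto $\mathbb{R}$; $\exp$ is its inverse; for $b>0$ and $x\in\mathbb{R}$, $b^x := \exp(x\log(b))$ (which agrees with the elementary power for integer exponents). $\cosh(t) := \frac{e^t+e^{-t}}{2}$, $\sinh(t) := \frac{e^t-e^{-t}}{2}$ where $e^t = \exp(t)$, $\tanh = \sinh/\cosh$, $\operatorname{sech} = 1/\cosh$; $\operatorname{arsinh}$ is the inverse of $\sinh$. $\arctan$ is the inverse of $\tan$ restricted to $(-\pi/2,\pi/2)$ and $\arcsin$ is the inverse of $\sin$ restricted to $[-\pi/2,\pi/2]$. The derivative is $\frac{d}{dx}F(x) := \lim_{h\to0}\frac{F(x+h)-F(x)}{h}$. *)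

(* Defs.v *)
From Stdlib Require Import Reals ClassicalEpsilon.
From Coquelicot Require Import Coquelicot.
Open Scope R_scope.

(* The inverse of the restriction of [f] to [D]; the value is unspecified at
   points outside [f D]. *)
Definition inverse_on (D : R -> Prop) (f : R -> R) (y : R) : R :=
  epsilon (inhabits 0) (fun x => D x /\ f x = y).

(* The library's [exp] is a power series and its [ln] the inverse of that
   series. Here the logarithm is a Riemann integral and the exponential its
   inverse. [RInt] is oriented: for [x < 1] it is minus the integral from [x]
   to [1]. *)
Definition Log (x : R) : R := RInt (fun t => / t) 1 x.

Definition Exp : R -> R := inverse_on (fun x => 0 < x) Log.

(* Meaningful for [0 < b] only; integer powers of an arbitrary base are written
   with the library's [powerRZ]. *)
Definition Pow (b x : R) : R := Exp (x * Log b).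

Definition Cosh (t : R) : R := (Exp t + Exp (- t)) / 2.
Definition Sinh (t : R) : R := (Exp t - Exp (- t)) / 2.
Definition Tanh (t : R) : R := Sinh t / Cosh t.
Definition Sech (t : R) : R := 1 / Cosh t.

(* The library's [arcsinh] and [asin] are closed formulas rather than inverse
   functions. Its [atan] is by construction the inverse of [tan] restricted to
   (-PI/2, PI/2), and needs no counterpart here. *)
Definition Arsinh : R -> R := inverse_on (fun _ => True) Sinh.
Definition Arcsin : R -> R :=
  inverse_on (fun t => - (PI / 2) <= t <= PI / 2) sin.

Definition Sec (x : R) : R := 1 / cos x.
Definition Csc (x : R) : R := 1 / sin x.
Definition Cot (x : R) : R := cos x / sin x.

(* Main.v *)
Require Import Defs.
From Stdlib Require Import Reals ClassicalEpsilon Lra Lia.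
From Coquelicot Require Import Coquelicot.
Open Scope R_scope.

(** The defining integral gives [Log = ln] on the positive reals, so all the
functions defined here by inversion agree with their library counterparts
wherever they are meaningful, and the rules follow by transporting the known
derivatives along these equalities. *)

(** The witness [x] shows that the choice made by [epsilon] does satisfy its specification, and
    injectivity on [D] leaves [x] as the only possible choice. *)
Lemma inverse_on_eq (D : R -> Prop) (f : R -> R) (x y : R) :
  (forall u v, D u -> D v -> f u = f v -> u = v) ->
  D x -> f x = y -> inverse_on D f y = x.
Proof.
  intros Hinj Dx Hxy; unfold inverse_on.
  destruct (epsilon_spec (inhabits 0) (fun t => D t /\ f t = y))
    as [De He]; [now exists x |].
  apply Hinj; [assumption | assumption | congruence].
Qed.

(** Fundamental theorem of calculus: [ln] is an antiderivative of the integrand and vanishes at the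
    lower endpoint 1. *)
Lemma Log_ln (x : R) : 0 < x -> Log x = ln x.
Proof.
  intros Hx; unfold Log.
  (* The segment between 1 and [x] stays in the positive reals in either order, so [x < 1] needs no
     separate case. *)
  assert (Hpos : forall t, Rmin 1 x <= t -> 0 < t).
  { intros t Ht; apply Rlt_le_trans with (2 := Ht).
    apply Rmin_glb_lt; lra. }
  apply is_RInt_unique.
  replace (ln x) with (minus (ln x) (ln 1))
    by (rewrite ln_1; unfold minus, plus, opp; simpl; ring).
  apply (is_RInt_derive ln (fun t => / t)).
  - intros t [Ht _]; apply is_derive_Reals, derivable_pt_lim_ln; auto.
  - intros t [Ht _]; apply continuous_Rinv, Rgt_not_eq, Hpos, Ht.
Qed.

(** The preimage of [x] under [Log] is [exp x]. It exists for every real [x], so the equality is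
    unconditional. *)
Lemma Exp_exp (x : R) : Exp x = exp x.
Proof.
  apply inverse_on_eq.
  - intros u v Hu Hv; rewrite !Log_ln by assumption; now apply ln_inv.
  - apply exp_pos.
  - rewrite Log_ln by apply exp_pos; apply ln_exp.
Qed.

Lemma Pow_Rpower (b x : R) : 0 < b -> Pow b x = Rpower b x.
Proof. intros Hb; unfold Pow; now rewrite Exp_exp, Log_ln. Qed.

Lemma Sinh_sinh (x : R) : Sinh x = sinh x.
Proof. unfold Sinh; now rewrite !Exp_exp. Qed.

Lemma Cosh_cosh (x : R) : Cosh x = cosh x.
Proof. unfold Cosh; now rewrite !Exp_exp. Qed.

(** [arcsinh] is a two-sided inverse: on the right it supplies the preimage, on the left it gives
    injectivity of [Sinh]. *)
Lemma Arsinh_arcsinh (x : R) : Arsinh x = arcsinh x.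
Proof.
  apply inverse_on_eq; [| exact I | rewrite Sinh_sinh; apply sinh_arcsinh].
  intros u v _ _; rewrite !Sinh_sinh; intros Huv.
  now rewrite <- (arcsinh_sinh u), Huv, arcsinh_sinh.
Qed.

(** Outside [-1, 1] no preimage exists and [Arcsin] is unspecified, hence the restriction on [x]. *)
Lemma Arcsin_asin (x : R) : -1 <= x <= 1 -> Arcsin x = asin x.
Proof.
  intros Hx; apply inverse_on_eq; [| apply asin_bound | now apply sin_asin].
  intros u v Hu Hv Huv.
  now rewrite <- (asin_sin u Hu), Huv, asin_sin.
Qed.

(** Derivatives are local: the interval (0, x + 1) is a neighbourhood of [x] on which both functions
    agree. This serves [Log] and [Pow] in its base, which match [ln] and [Rpower] on positive
    arguments. *)
Lemma derivable_pt_lim_pos_ext (f g : R -> R) (x l : R) :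
  0 < x -> (forall t, 0 < t -> f t = g t) ->
  derivable_pt_lim f x l -> derivable_pt_lim g x l.
Proof.
  intros Hx Hfg; apply derivable_pt_lim_locally_ext with (a := 0) (b := x + 1).
  - lra.
  - intros z Hz; now apply Hfg.
Qed.

Lemma derivable_pt_lim_powerRZ_pos (a : Z) (x : R) :
  (0 < a)%Z ->
  derivable_pt_lim (fun t => powerRZ t a) x (IZR a * powerRZ x (a - 1)).
Proof.
  intros Ha.
  (* Naming [a - 1] rather than [a] makes both exponents natural powers, [S n] and [n], so [x = 0]
     is covered. *)
  destruct (IZN (a - 1)) as [n Hn]; [lia |].
  replace a with (Z.of_nat (S n)) by lia.
  replace (Z.of_nat (S n) - 1)%Z with (Z.of_nat n) by lia.
  rewrite <- pow_powerRZ, <- INR_IZR_INZ.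
  apply derivable_pt_lim_ext with (f := fun t => t ^ S n).
  - intros t; apply pow_powerRZ.
  - apply (derivable_pt_lim_pow x (S n)).
Qed.

Lemma derivable_pt_lim_powerRZ_nonpos (a : Z) (x : R) :
  (a <= 0)%Z -> x <> 0 ->
  derivable_pt_lim (fun t => powerRZ t a) x (IZR a * powerRZ x (a - 1)).
Proof.
  intros Ha Hx.
  destruct (IZN (- a)) as [n Hn]; [lia |].
  replace a with (- Z.of_nat n)%Z by lia.
  replace (- Z.of_nat n - 1)%Z with (- Z.of_nat (S n))%Z by lia.
  rewrite powerRZ_neg', <- pow_powerRZ, opp_IZR, <- INR_IZR_INZ.
  apply derivable_pt_lim_ext with (f := fun t => / t ^ n).
  (* The two functions agree at every [t], even at 0, by the convention for [/ 0]. *)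
  - intros t; now rewrite powerRZ_neg', <- pow_powerRZ.
  - assert (Hxn : x ^ n <> 0) by now apply pow_nonzero.
    apply is_derive_Reals.
    replace (- INR n * / x ^ S n) with (- (INR n * x ^ pred n) / (x ^ n) ^ 2).
    + apply is_derive_inv; [| assumption].
      apply is_derive_Reals, derivable_pt_lim_pow.
    (* For [n = 0], [pred n] is 0 instead of -1, but the factor [INR 0] makes both sides vanish. *)
    + destruct n as [| n]; [simpl; field; assumption |].
      assert (x ^ n <> 0) by now apply pow_nonzero.
      rewrite Nat.pred_succ; simpl pow; field; auto.
Qed.

Lemma derivable_pt_lim_Pow_base (a x : R) :
  0 < x -> derivable_pt_lim (fun t => Pow t a) x (a * Pow x (a - 1)).
Proof.
  intros Hx; rewrite Pow_Rpower by assumption.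
  apply derivable_pt_lim_pos_ext with (f := fun t => Rpower t a).
  - assumption.
  - intros t Ht; now rewrite Pow_Rpower.
  - now apply derivable_pt_lim_power.
Qed.

(** [Log b] is a constant here, so this is the chain rule for the exponential of a linear
    function. *)
Lemma derivable_pt_lim_Pow_exponent (b x : R) :
  derivable_pt_lim (fun t => Pow b t) x (Pow b x * Log b).
Proof.
  unfold Pow; rewrite Exp_exp.
  apply derivable_pt_lim_ext with (f := fun t => exp (t * Log b)).
  - intros t; now rewrite Exp_exp.
  - apply is_derive_Reals; auto_derive; [exact I | ring].
Qed.

Lemma derivable_pt_lim_Cot (x : R) :
  sin x <> 0 -> derivable_pt_lim Cot x (- (Csc x ^ 2)).
Proof.
  intros Hx; apply is_derive_Reals; unfold Cot, Csc.
  (* The target is put in the form produced by the quotient rule; the Pythagorean identity reduces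
     its numerator to -1. *)
  replace (- (1 / sin x) ^ 2)
    with ((- sin x * sin x - cos x * cos x) / sin x ^ 2).
  - apply is_derive_div; [| | assumption]; apply is_derive_Reals.
    + apply derivable_pt_lim_cos.
    + apply derivable_pt_lim_sin.
  - pose proof (sin2_cos2 x) as H; unfold Rsqr in H.
    replace (- sin x * sin x - cos x * cos x) with (-1) by lra.
    field; assumption.
Qed.

Lemma derivable_pt_lim_tan_sec (x : R) :
  cos x <> 0 -> derivable_pt_lim tan x (Sec x ^ 2).
Proof.
  intros Hx; apply is_derive_Reals; unfold Sec.
  replace ((1 / cos x) ^ 2) with (tan x ^ 2 + 1); [now apply is_derive_tan |].
  pose proof (sin2_cos2 x) as H; unfold Rsqr in H.
  unfold tan.
  replace ((sin x / cos x) ^ 2 + 1)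
    with ((sin x * sin x + cos x * cos x) / cos x ^ 2) by now field.
  rewrite H; now field.
Qed.

Lemma derivable_pt_lim_Arcsin (x : R) :
  -1 < x < 1 -> derivable_pt_lim Arcsin x (1 / sqrt (1 - x ^ 2)).
Proof.
  intros Hx.
  apply derivable_pt_lim_locally_ext with (f := asin) (a := -1) (b := 1);
    [assumption | intros z Hz; symmetry; apply Arcsin_asin; lra |].
  (* Passes from the limit to the value of [derive_pt], the form in which the derivative of [asin]
     is known. *)
  apply derive_pt_eq_1 with (pr := derivable_pt_asin x Hx).
  rewrite derive_pt_asin; now rewrite Rsqr_pow2.
Qed.

Lemma derivable_pt_lim_Sinh (x : R) : derivable_pt_lim Sinh x (Cosh x).
Proof.
  rewrite Cosh_cosh.
  apply derivable_pt_lim_ext with (f := sinh).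
  - intros t; now rewrite Sinh_sinh.
  - apply derivable_pt_lim_sinh.
Qed.

Lemma derivable_pt_lim_Cosh (x : R) : derivable_pt_lim Cosh x (Sinh x).
Proof.
  rewrite Sinh_sinh.
  apply derivable_pt_lim_ext with (f := cosh).
  - intros t; now rewrite Cosh_cosh.
  - apply derivable_pt_lim_cosh.
Qed.

Lemma derivable_pt_lim_Tanh (x : R) : derivable_pt_lim Tanh x (Sech x ^ 2).
Proof.
  assert (Hpos : Cosh x <> 0).
  { unfold Cosh; rewrite !Exp_exp.
    pose proof (exp_pos x); pose proof (exp_pos (- x)); lra. }
  assert (Hone : Cosh x * Cosh x - Sinh x * Sinh x = 1).
  (* With [exp (- x)] turned into [/ exp x], the identity is rational in [exp x]. It is what
     simplifies the quotient rule numerator below. *)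
  { unfold Cosh, Sinh; rewrite !Exp_exp, exp_Ropp.
    field; apply Rgt_not_eq, exp_pos. }
  apply is_derive_Reals; unfold Tanh, Sech.
  replace ((1 / Cosh x) ^ 2)
    with ((Cosh x * Cosh x - Sinh x * Sinh x) / Cosh x ^ 2)
    by (rewrite Hone; now field).
  apply is_derive_div; [| | assumption]; apply is_derive_Reals.
  - apply derivable_pt_lim_Sinh.
  - apply derivable_pt_lim_Cosh.
Qed.

Lemma derivable_pt_lim_Arsinh (x : R) :
  derivable_pt_lim Arsinh x (1 / sqrt (1 + x ^ 2)).
Proof.
  apply derivable_pt_lim_ext with (f := arcsinh).
  - intros t; now rewrite Arsinh_arcsinh.
  - unfold Rdiv; rewrite Rmult_1_l, Rplus_comm.
    apply derivable_pt_lim_arcsinh.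
Qed.

Theorem theorem7p1 :
  (forall x : R, derivable_pt_lim Exp x (Exp x)) /\
  (forall x : R, 0 < x -> derivable_pt_lim Log x (1 / x)) /\
  ((forall a x : R, 0 < x ->
      derivable_pt_lim (fun t => Pow t a) x (a * Pow x (a - 1))) /\
   (forall (a : Z) (x : R), (0 < a)%Z ->
      derivable_pt_lim (fun t => powerRZ t a) x (IZR a * powerRZ x (a - 1))) /\
   (forall (a : Z) (x : R), (a <= 0)%Z -> x <> 0 ->
      derivable_pt_lim (fun t => powerRZ t a) x (IZR a * powerRZ x (a - 1)))) /\
  (forall b : R, 0 < b -> forall x : R,
      derivable_pt_lim (fun t => Pow b t) x (Pow b x * Log b)) /\
  ((forall x : R, derivable_pt_lim sin x (cos x)) /\
   (forall x : R, derivable_pt_lim cos x (- sin x))) /\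
  (forall x : R, cos x <> 0 -> derivable_pt_lim tan x (Sec x ^ 2)) /\
  (forall x : R, sin x <> 0 -> derivable_pt_lim Cot x (- (Csc x ^ 2))) /\
  (forall x : R, derivable_pt_lim atan x (1 / (1 + x ^ 2))) /\
  (forall x : R, -1 < x < 1 ->
      derivable_pt_lim Arcsin x (1 / sqrt (1 - x ^ 2))) /\
  ((forall x : R, derivable_pt_lim Sinh x (Cosh x)) /\
   (forall x : R, derivable_pt_lim Cosh x (Sinh x)) /\
   (forall x : R, derivable_pt_lim Tanh x (Sech x ^ 2))) /\
  (forall x : R, derivable_pt_lim Arsinh x (1 / sqrt (1 + x ^ 2))).
Proof.
  split; [| split; [| split; [split; [| split] | split; [| split; [split |
    split; [| split; [| split; [| split; [| split; [split; [| split] |]]]]]]]]]].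
  - intros x; rewrite Exp_exp.
    apply derivable_pt_lim_ext with (f := exp).
    + intros t; now rewrite Exp_exp.
    + apply derivable_pt_lim_exp.
  - intros x Hx; unfold Rdiv; rewrite Rmult_1_l.
    apply derivable_pt_lim_pos_ext with (f := ln).
    + assumption.
    + intros t Ht; now rewrite Log_ln.
    + now apply derivable_pt_lim_ln.
  - exact derivable_pt_lim_Pow_base.
  - exact derivable_pt_lim_powerRZ_pos.
  - exact derivable_pt_lim_powerRZ_nonpos.
  - intros b _ x; apply derivable_pt_lim_Pow_exponent.
  - exact derivable_pt_lim_sin.
  - exact derivable_pt_lim_cos.
  - exact derivable_pt_lim_tan_sec.
  - exact derivable_pt_lim_Cot.
  - intros x; unfold Rdiv; rewrite Rmult_1_l; apply derivable_pt_lim_atan.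
  - exact derivable_pt_lim_Arcsin.
  - exact derivable_pt_lim_Sinh.
  - exact derivable_pt_lim_Cosh.
  - exact derivable_pt_lim_Tanh.
  - exact derivable_pt_lim_Arsinh.
Qed.
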